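(* Let $\mathfrak g$ be a profinite-dimensional $\mathbb K$-Lie algebra, and for $J\subseteq I$ in $\mathcal I(\mathfrak g)$ let $p_I\colon\mathfrak g\to\mathfrak g/I$ and $p_{IJ}\colon\mathfrak g/J\to\mathfrak g/I$ be the quotient morphisms. Then $\{\mathbf U(\mathfrak g/I),\mathbf U(p_{IJ})\}$ is an inverse system of weakly complete unital algebras, and the natural morphism $\omega_{\mathfrak g}\colon\mathbf U(\mathfrak g)\to\lim_{I\in\mathcal I(\mathfrak g)}\mathbf U(\mathfrak g/I)$, whose composition with the limit projection onto $\mathbf U(\mathfrak g/I)$ is $\mathbf U(p_I)$ for every $I$, is an isomorphism of weakly complete unital algebras. In short, $\mathbf U(\lim_{I}\mathfrak g/I)=\mathbf U(\mathfrak g)\cong\lim_{I}\mathbf U(\mathfrak g/I)$.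
   Context: $\mathbb K\in\{\mathbb R,\mathbb C\}$. A topological $\mathbb K$-vector space is weakly complete if it is isomorphic to a power $\mathbb K^J$ (with the product topology) for some set $J$. A weakly complete unital algebra is a unital associative $\mathbb K$-algebra $A$ carrying a topology that makes it a weakly complete vector space and makes multiplication continuous; morphisms are continuous unital algebra homomorphisms. For such $A$, $[A]$ denotes the topological Lie algebra with the same underlying topological vector space and bracket $[x,y]=xy-yx$. For a topological $\mathbb K$-Lie algebra $\mathfrak g$ let $\mathcal I(\mathfrak g)$ be the set of closed ideals $I$ of $\mathfrak g$ with $\dim \mathfrak g/I<\infty$; $\mathfrak g$ is profinite-dimensional if the natural map $\mathfrak g\to\lim_{I\in\mathcal I(\mathfrak g)}\mathfrak g/I$ is an isomorphism of topological Lie algebras. The weakly complete enveloping algebra of a profinite-dimensional Lie algebra $\mathfrak g$ is a weakly complete unital algebra $\mathbf U(\mathfrak g)$ together with a continuous Lie algebra morphism $\lambda_{\mathfrak g}\colon\mathfrak g\to[\mathbf U(\mathfrak g)]$ such that for every weakly complete unital algebra $A$ and every continuous Lie algebra morphism $f\colon\mathfrak g\to[A]$ there is a unique continuous unital algebra morphism $f'\colon\mathbf U(\mathfrak g)\to A$ with $f=f'\circ\lambda_{\mathfrak g}$; $\mathbf U$ is a functor (left adjoint to $A\mapsto[A]$). *)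

(* Defs.v *)
From HB Require Import structures.
From mathcomp Require Import all_boot all_order all_algebra.
From mathcomp Require Import complex.
From mathcomp Require Import all_classical all_reals all_analysis.
Import numFieldTopology.Exports.

Set Implicit Arguments.
Unset Strict Implicit.
Unset Printing Implicit Defensive.

Import Order.TTheory GRing.Theory Num.Theory.
Local Open Scope classical_set_scope.
Local Open Scope ring_scope.

(** The ground field K in {R, C}: [Kfield R true] is the real field R,
    [Kfield R false] is the complex field R[i] (both with their norm
    topology), where R is a model of the real numbers. *)
Definition Kfield (R : realType) (b : bool) : numFieldType :=
  if b then (R : numFieldType) else ((R[i])%C : numFieldType).

(** Topological unital associative K-algebras (the topology makes it a
    topological vector space; continuity of multiplication is a separate
    condition, see [wc_algebra]). *)
#[short(type="topAlgType")]
HB.structure Definition TopAlgebra (K : numDomainType) :=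
  {A of TopologicalLmodule K A & GRing.Algebra K A}.

Section Defs.
Variable K : numFieldType.

Definition weakly_complete (V : topologicalLmodType K) : Prop :=
  exists (J : Type) (f : V -> {ptws J -> K}) (g : {ptws J -> K} -> V),
    [/\ forall (a : K) (x y : V) (j : J), f (a *: x + y) j = a * f x j + f y j,
        cancel f g, cancel g f, continuous f & continuous g].

Definition wc_algebra (A : topAlgType K) : Prop :=
  weakly_complete A /\ continuous (fun z : A * A => z.1 * z.2).

Definition wc_morph (A B : topAlgType K) (f : A -> B) : Prop :=
  [/\ forall (a : K) (x y : A), f (a *: x + y) = a *: f x + f y,
      forall x y : A, f (x * y) = f x * f y,
      f 1 = 1 & continuous f].

Definition topLie (g : topologicalLmodType K) (br : g -> g -> g) : Prop :=
  [/\ forall (a : K) (x y z : g), br (a *: x + y) z = a *: br x z + br y z,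
      forall (a : K) (x y z : g), br z (a *: x + y) = a *: br z x + br z y,
      forall x : g, br x x = 0,
      forall x y z : g, br x (br y z) + br y (br z x) + br z (br x y) = 0
    & continuous (fun w : g * g => br w.1 w.2)].

Definition lie_to_alg (g : topologicalLmodType K) (br : g -> g -> g)
    (A : topAlgType K) (f : g -> A) : Prop :=
  [/\ forall (a : K) (x y : g), f (a *: x + y) = a *: f x + f y,
      forall x y : g, f (br x y) = f x * f y - f y * f x
    & continuous f].

Definition enveloping (g : topologicalLmodType K) (br : g -> g -> g)
    (U : topAlgType K) (lam : g -> U) : Prop :=
  [/\ wc_algebra U, lie_to_alg br lam &
      forall (A : topAlgType K), wc_algebra A ->
      forall f : g -> A, lie_to_alg br f ->
      exists f' : U -> A, [/\ wc_morph f', forall x, f x = f' (lam x) &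
        forall h : U -> A, wc_morph h -> (forall x, f x = h (lam x)) ->
          forall u, h u = f' u]].

Definition fincodim_ideal (g : topologicalLmodType K) (br : g -> g -> g)
    (I : set g) : Prop :=
  [/\ closed I, I 0,
      forall (a : K) (x y : g), I x -> I y -> I (a *: x + y),
      forall x y : g, I y -> I (br x y) &
      exists (n : nat) (v : 'I_n -> g), forall x : g,
        exists c : 'I_n -> K, I (x - \sum_(k < n) c k *: v k)].

Definition ideal_idx (g : topologicalLmodType K) (br : g -> g -> g) :=
  {I : set g | fincodim_ideal br I}.

Definition lie_quotient (g : topologicalLmodType K) (br : g -> g -> g)
    (I : set g) (Q : topologicalLmodType K) (brQ : Q -> Q -> Q) (p : g -> Q) :=
  [/\ topLie brQ,
      (forall (a : K) (x y : g), p (a *: x + y) = a *: p x + p y) /\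
      (forall x y : g, p (br x y) = brQ (p x) (p y)),
      (forall q : Q, exists x, p x = q),
      (forall x : g, p x = 0 <-> I x) &
      forall V : set Q, open V <-> open (p @^-1` V)].

End Defs.

Definition prodT (Ix : Type) (T : Ix -> topologicalType) : topologicalType :=
  prod_topology T.

Definition homeo_onto (X Y : topologicalType) (f : X -> Y) (L : set Y) : Prop :=
  [/\ injective f, range f = L, continuous f &
      exists h : Y -> X, (forall x, h (f x) = x) /\ {within L, continuous h}].

Definition quot_limit (K : numFieldType) (g : topologicalLmodType K)
    (br : g -> g -> g) (Q : ideal_idx br -> topologicalLmodType K)
    (p : forall i, g -> Q i) : set (prodT (fun i => Q i : topologicalType)) :=
  [set y | forall (i j : ideal_idx br), sval j `<=` sval i ->
             forall x : g, p j x = y j -> p i x = y i].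

(** g is profinite-dimensional: g -> lim_I g/I is an isomorphism of
    topological Lie algebras (the algebraic structure being componentwise,
    this is a bijection onto the limit which is a homeomorphism). *)
Definition profinite_dim (K : numFieldType) (g : topologicalLmodType K)
    (br : g -> g -> g) (Q : ideal_idx br -> topologicalLmodType K)
    (p : forall i, g -> Q i) : Prop :=
  homeo_onto (fun x : g => (fun i => p i x) : prodT (fun i => Q i : topologicalType))
    (quot_limit p).

(* Main.v *)
(**
A continuous functional f on a weakly complete algebra A makes f (x y) a
bilinear form depending on finitely many coordinates, hence of finite rank;
so f is a matrix coefficient of a continuous finite-dimensional representation
of A. For A = U(g) the kernel of that representation, restricted to g, is an
ideal I in I(g), so f factors through U(g/I). Applied to the coordinates of
U(g), this yields a continuous left inverse theta, defined on the whole
product, of omega.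

That omega (theta y) = y for y in the limit is checked on coordinates. Such a
coordinate involves finitely many indices, all of which lie above a common k,
and the identity becomes the vanishing on U(g/k) of a continuous functional
that vanishes on the image of U(g). This image is a subspace containing 1 and
stable under right multiplication by generators, and such a subspace D is
dense: in the representation rho attached to a functional f vanishing on D, a
projector E onto the invariant subspace of row vectors coming from D makes
E rho a Lie morphism on the generators; its extension tau satisfies
tau E = E rho, which forces f = 0.
*)

Require Import Defs.
From HB Require Import structures.
From mathcomp Require Import all_boot all_order all_algebra.
From mathcomp Require Import all_classical all_reals all_analysis.
Import numFieldTopology.Exports.
Import Order.TTheory GRing.Theory Num.Theory.
Local Open Scope classical_set_scope.
Local Open Scope ring_scope.

Set Implicit Arguments.
Unset Strict Implicit.
Unset Printing Implicit Defensive.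

(** Joins the topological and algebra structures, making ['M[K]_n.+1] a [topAlgType] to which the
    universal properties apply. *)
HB.instance Definition _ (K : numFieldType) (n : nat) :=
  GRing.Algebra.on 'M[K]_n.+1.

(** * Product topologies *)

Section ProductTopology.
Context {I : Type} {T : I -> topologicalType}.

Lemma cvg_prod_topology (F : set_system (prod_topology T))
    (x : prod_topology T) : Filter F ->
  (forall i, (fun y : prod_topology T => y i) @ F --> x i) -> F --> x.
Proof.
move=> FF cF; apply/cvg_sup => i A [B [[C oC <-] Cx] sB].
by apply: filterS sB _; apply: cF; exact: open_nbhs_nbhs.
Qed.

Lemma eval_continuous (i : I) : continuous (fun y : prod_topology T => y i).
Proof.
move=> x; have /cvg_sup/(_ i) cx : x --> x by exact: cvg_id.
by move=> A Ax; apply: cx; exact: initial_continuous.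
Qed.

Lemma continuous_prod_topology (X : topologicalType) (h : X -> prod_topology T) :
  (forall i, continuous (fun x => h x i)) -> continuous h.
Proof.
by move=> ch x; apply: cvg_prod_topology => i; apply: cvg_trans (ch i x).
Qed.

End ProductTopology.

(** The sets admitting such data form a filter, and it converges to 0 because every evaluation does;
    intersecting finitely many sets leaves a single [U]. *)
Lemma ptws_nbhs0 (K : numFieldType) (J : Type) (A : set {ptws J -> K}) :
  nbhs ((fun=> 0) : {ptws J -> K}) A ->
  exists (N : nat) (s : 'I_N -> J) (U : set K),
    nbhs (0 : K) U /\ forall y : J -> K, (forall k, U (y (s k))) -> A y.
Proof.
pose F := [set B : set {ptws J -> K} |
  exists (N : nat) (s : 'I_N -> J) (U : set K),
    nbhs (0 : K) U /\ forall y : J -> K, (forall k, U (y (s k))) -> B y].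
have FF : Filter F.
  split.
  - have s : 'I_0 -> J by case.
    by exists 0%N, s, setT; split=> //; exact: filterT.
  - move=> P Q [n [s [U [U0 sP]]]] [m [t [V [V0 tQ]]]].
    exists (n + m)%N, (fun k => match fintype.split k with
      inl a => s a | inr b => t b end), (U `&` V).
    split=> [|y yUV]; first exact: filterI.
    split; [apply: sP => k|apply: tQ => k].
      by have [] := yUV (lshift m k); rewrite (unsplitK (inl k)).
    by have [] := yUV (rshift n k); rewrite (unsplitK (inr k)).
  - move=> P Q PQ [n [s [U [U0 sP]]]]; exists n, s, U; split=> // y /sP.
    exact: PQ.
suff cF : cvg_to F (nbhs ((fun=> 0) : {ptws J -> K})) by move/cF.
apply: cvg_prod_topology => j U U0; exists 1%N, (fun=> j), U; split=> // y.
by apply; exact: ord0.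
Qed.

(** * Matrix algebras as weakly complete algebras *)

Section MatrixTopology.
Context {K : numFieldType}.

Lemma mx_continuous (X : topologicalType) (m n : nat) (F : X -> 'M[K]_(m, n)) :
  (forall i j, continuous (fun x => F x i j)) -> continuous F.
Proof.
move=> cF x A [B Bx sB].
have nB : \forall y \near x, forall i j, B i j (F y i j).
  by do 2![apply: filter_forall => ?]; exact: (cF _ _ x _ (Bx _ _)).
by apply: filterS nB => y yB; exact: sB.
Qed.

Lemma sum_continuous (X : topologicalType) (n : nat) (F : 'I_n -> X -> K) :
  (forall i, continuous (F i)) -> continuous (fun x => \sum_i F i x).
Proof.
move=> cF; elim: n F cF => [|n IH] F cF x.
  rewrite (_ : (fun y => _) = fun=> 0); first exact: cvg_cst.
  by apply/funext => y; rewrite big_ord0.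
rewrite (_ : (fun y => _) = (F ord0) \+ (fun y => \sum_i F (lift ord0 i) y)).
  exact: (@cvgD _ K^o _ _ _ _ _ _ _ (cF ord0 x) (IH (fun i => F (lift ord0 i)) (fun=> cF _) x)).
by apply/funext => y; rewrite big_ord_recl.
Qed.

Lemma mulmx_continuous (X : topologicalType) (m n k : nat)
    (F : X -> 'M[K]_(m, n)) (G : X -> 'M[K]_(n, k)) :
  continuous F -> continuous G -> continuous (fun x => F x *m G x).
Proof.
move=> cF cG; apply: mx_continuous => i j.
rewrite (_ : (fun x => _) = fun x => \sum_l F x i l * G x l j); last first.
  by apply/funext => x; rewrite mxE.
apply: sum_continuous => l x; apply: (@continuousM _ _ (fun y => F y i l) (fun y => G y l j)).
  apply: (@continuous_comp _ _ _ F (fun M : 'M[K]_(m, n) => M i l)).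
    exact: cF.
  exact: coord_continuous.
apply: (@continuous_comp _ _ _ G (fun M : 'M[K]_(n, k) => M l j)).
  exact: cG.
exact: coord_continuous.
Qed.

Lemma matrix_wc_algebra (n : nat) : wc_algebra 'M[K]_n.+1.
Proof.
split; last first.
  apply: (@mulmx_continuous ('M[K]_n.+1 * 'M[K]_n.+1)%type _ _ _ fst snd) => x.
    exact: cvg_fst.
  exact: cvg_snd.
exists ('I_n.+1 * 'I_n.+1)%type, (fun (M : 'M[K]_n.+1) ij => M ij.1 ij.2),
  (fun y => \matrix_(i, j) y (i, j)); split.
- by move=> a x y [i j]; rewrite !mxE.
- by move=> M; apply/matrixP => i j; rewrite mxE.
- by move=> y; apply/funext => -[i j]; rewrite mxE.
- by apply: continuous_prod_topology => ij; exact: coord_continuous.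
- apply: mx_continuous => i j; rewrite (_ : (fun x => _) = fun x => x (i, j)).
    exact: eval_continuous.
  by apply/funext => x; rewrite mxE.
Qed.

End MatrixTopology.

(** * Finite-dimensional linear algebra *)

Section LinearAlgebra.
Context {K : fieldType}.

Lemma linear0P (V W : lmodType K) (f : V -> W) : linear f -> f 0 = 0.
Proof. by move=> lf; have := lf (-1) 0 0; rewrite scaler0 addr0 scaleN1r addNr. Qed.

Lemma linear_sumP (V W : lmodType K) (f : V -> W) : linear f ->
  forall (n : nat) (e : 'I_n -> K) (v : 'I_n -> V),
    f (\sum_k e k *: v k) = \sum_k e k *: f (v k).
Proof.
move=> lf; elim=> [|n IH] e v; first by rewrite !big_ord0 (linear0P lf).
by rewrite !big_ord_recl lf IH.
Qed.

Lemma linearBP (V W : lmodType K) (f : V -> W) : linear f ->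
  forall x y, f (x - y) = f x - f y.
Proof. by move=> lf x y; rewrite addrC -scaleN1r lf scaleN1r addrC. Qed.

Lemma linearZP (V W : lmodType K) (f : V -> W) : linear f ->
  forall a x, f (a *: x) = a *: f x.
Proof. by move=> lf a x; rewrite -[a *: x]addr0 lf (linear0P lf) addr0. Qed.

(** Among the matrices with row space inside [S], one of maximal rank spans [S]: adjoining a missing
    vector of [S] would raise the rank. *)
Lemma subspace_basis (m : nat) (S : set 'rV[K]_m) : S 0 ->
  (forall a x y, S x -> S y -> S (a *: x + y)) ->
  exists (n : nat) (M : 'M[K]_(n, m)),
    row_free M /\ forall v, S v <-> (v <= M)%MS.
Proof.
move=> S0 SD.
pose P := fun r => `[< exists M : 'M[K]_m, \rank M = r /\
  forall v : 'rV_m, (v <= M)%MS -> S v >].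
have exP : exists r, P r.
  exists 0%N; apply/asboolP; exists 0; split; first exact: mxrank0.
  by move=> v /submx0null ->.
have ubP r : P r -> (r <= m)%N.
  by move=> /asboolP [M [<- _]]; exact: rank_leq_row.
case: (ex_maxnP exP ubP) => r /asboolP [M [rM SM]] maxr.
exists (\rank M), (row_base M); split; first exact: row_base_free.
move=> v; rewrite eq_row_base; split=> [Sv|]; last exact: SM.
have SMv w : (w <= M + v)%MS -> S w.
  case/sub_addsmxP => -[w1 w2] /= ->.
  have [a ->] : exists a : K, w2 *m v = a *: v.
    by exists (w2 0 0); rewrite [w2]mx11_scalar mul_scalar_mx !mxE eqxx mulr1n.
  by rewrite addrC; apply: SD => //; apply: SM; exact: submxMl.
have : P (\rank (M + v)%MS) by apply/asboolP; exists (M + v)%MS.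
move=> /maxr; rewrite -rM => le.
have := mxrank_leqif_sup (addsmxSl M v).
move=> /leqifP; case: ifP => [sub _|_]; last by rewrite ltnNge le.
by apply: submx_trans sub; exact: addsmxSr.
Qed.

(* Stated for a relation rather than a linear map, so that it also covers the
   intersection of two ideals without forming their quotients. *)
Lemma relation_fincodim (V : lmodType K) (m : nat) (T : V -> 'rV[K]_m -> Prop) :
  T 0 0 ->
  (forall a x y c d, T x c -> T y d -> T (a *: x + y) (a *: c + d)) ->
  (forall x, exists c, T x c) ->
  exists (n : nat) (v : 'I_n -> V),
    forall x, exists e : 'I_n -> K, T (x - \sum_(k < n) e k *: v k) 0.
Proof.
move=> T0 TD Ttot.
have [||n [M [fM SM]]] := @subspace_basis m [set c | exists x, T x c].
- by exists 0.
- by move=> a c d [x Tx] [y Ty]; exists (a *: x + y); exact: TD.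
have vP k : exists v, T v (row k M) by apply/SM; exact: row_sub.
have [v Tv] := choice vP.
have Tsum (D : 'rV[K]_n) : T (\sum_k D 0 k *: v k) (D *m M).
  rewrite mulmx_sum_row; apply: (big_ind2 T) => //.
    by move=> x1 c1 x2 c2 T1 T2; rewrite -[x1]scale1r -[c1]scale1r; exact: TD.
  by move=> k _; rewrite -[_ *: v k]addr0 -[_ *: row k M]addr0; exact: TD.
exists n, v => x; have [c Tc] := Ttot x.
have /SM/submxP [D cD] : [set c | exists x, T x c] c by exists x.
exists (D 0); have := TD (-1) _ _ _ _ (Tsum D) Tc.
by rewrite !scaleN1r -cD addNr addrC.
Qed.

(** Finitely many vectors [v] span [V] modulo the kernel of [c], which [H] ignores on both sides; so
    the Gram matrix [B] of [v] determines [H]. *)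
Lemma dual_bases (V : lmodType K) (H : V -> V -> K) (N : nat) (c : V -> 'rV[K]_N) :
  (forall y, linear (H ^~ y : V -> K^o)) -> (forall x, linear (H x : V -> K^o)) ->
  linear c -> (forall x, c x = 0 -> forall y, H x y = 0 /\ H y x = 0) ->
  exists (n : nat) (a b : 'I_n -> V),
    (forall k l, H (b k) (a l) = (k == l)%:R) /\
    (forall x y, H x y = \sum_k H x (a k) * H (b k) y).
Proof.
move=> lHl lHr lc Hc0.
have [||x|n [v vP]] := @relation_fincodim V N (fun x d => c x = d).
- exact: linear0P.
- by move=> a x y _ _ <- <-; rewrite lc.
- by exists (c x).
pose comb (e : 'I_n -> K) := \sum_k e k *: v k.
pose B := \matrix_(i, j) H (v i) (v j).
have HB (p : 'rV_n) (q : 'cV_n) :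
    H (comb (p 0)) (comb (q ^~ 0)) = (p *m B *m q) 0 0.
  rewrite (linear_sumP (lHl _)) -mulmxA mxE; apply: eq_bigr => i _.
  rewrite (linear_sumP (lHr _)) !mxE; congr (_ * _); apply: eq_bigr => j _.
  by rewrite mxE mulrC.
have Hcomb x : exists p : 'rV_n, forall y,
    H x y = H (comb (p 0)) y /\ H y x = H y (comb (p 0)).
  have [e /Hc0 ce] := vP x; exists (\row_k e k) => y; have [cl cr] := ce y.
  have -> : comb ((\row_k e k) 0) = \sum_k e k *: v k.
    by apply: eq_bigr => k _; rewrite mxE.
  move: cl cr; rewrite (linearBP (lHl y)) (linearBP (lHr y)).
  by move=> /eqP; rewrite subr_eq0 => /eqP -> /eqP; rewrite subr_eq0 => /eqP ->.
(* A rank factorisation of [B] with one-sided inverses. The columns of [Y] and the rows of [X] give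
   the dual families, since [X *m B *m Y = 1]. *)
have [r [C [L [X [Y [XC LY CL]]]]]] : exists r (C : 'M[K]_(n, r)) (L : 'M[K]_(r, n))
    (X : 'M[K]_(r, n)) (Y : 'M[K]_(n, r)), [/\ X *m C = 1%:M, L *m Y = 1%:M & C *m L = B].
  exists (\rank B), (col_base B), (row_base B).
  exists (pinvmx (col_base B)), (pinvmx (row_base B)); split.
  - by apply: mulVpmx; exact: col_base_full.
  - by apply: mulmxVp; exact: row_base_free.
  - exact: mulmx_base.
pose a l := comb (col l Y ^~ 0); pose b k := comb (row k X 0).
have colY l (u : 'rV_n) : (u *m col l Y) 0 0 = (u *m Y) 0 l.
  by rewrite !mxE; apply: eq_bigr => i _; rewrite !mxE.
have rowX k (u : 'cV_n) : (row k X *m u) 0 0 = (X *m u) k 0.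
  by rewrite !mxE; apply: eq_bigr => i _; rewrite !mxE.
exists r, a, b; split=> [k l|x y].
  by rewrite HB colY -mulmxA -row_mul mxE -CL mulmxA mulmxA XC mul1mx LY mxE.
have [p px] := Hcomb x; have [q qy] := Hcomb y.
have qE : comb (q 0) = comb (q^T ^~ 0) by apply: eq_bigr => k _; rewrite mxE.
have -> : H x y = (p *m C *m (L *m q^T)) 0 0.
  by rewrite (px y).1 (qy _).2 qE HB -CL !mulmxA.
rewrite mxE; apply: eq_bigr => k _; rewrite (px _).1 (qy _).2 qE !HB; congr (_ * _).
  by rewrite colY -CL !mulmxA -(mulmxA (p *m C)) LY mulmx1.
by rewrite -mulmxA rowX -CL !mulmxA XC mul1mx.
Qed.
End LinearAlgebra.

(** * Continuous functionals on weakly complete spaces and algebras *)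

Section WeaklyComplete.
Context {K : numFieldType}.

Lemma bounded_multiples_eq0 (z : K) : (forall t, `|t * z| < 1) -> z = 0.
Proof.
move=> zb; apply/eqP/negPn/negP => z0.
by have := zb z^-1; rewrite mulVf // normr1 ltxx.
Qed.

Lemma scale_to0 (V : topologicalLmodType K) (A : set V) (x : V) :
  nbhs (0 : V) A -> exists t : K, t != 0 /\ A (t *: x).
Proof.
move=> A0.
have : nbhs ((0 : K^o), x) [set z : K^o * V | A (z.1 *: z.2)].
  by apply: scale_continuous => /=; rewrite scale0r.
case=> -[P Q] /= [P0 Qx] PQ.
have /nbhs_ballP [e /= e0 eP] := P0.
exists (e / 2); split; first by rewrite lt0r_neq0 // divr_gt0.
apply: (PQ (e / 2, x)); split => /=; last exact: nbhs_singleton.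
apply: eP; rewrite /ball /= sub0r normrN gtr0_norm ?divr_gt0 //.
by rewrite ltr_pdivrMr // ltr_pMr // ltr1n.
Qed.

(* The multiples of x stay in A and A absorbs y, so all multiples of H x y are
   bounded by 1. *)
Lemma bounded_bilinear_eq0 (V : topologicalLmodType K) (H : V -> V -> K)
    (A : set V) (x y : V) :
  (forall y, linear (H ^~ y : V -> K^o)) ->
  (forall x, linear (H x : V -> K^o)) ->
  nbhs (0 : V) A -> (forall x y, A x -> A y -> `|H x y| < 1) ->
  (forall t, A (t *: x)) -> H x y = 0.
Proof.
move=> lHl lHr A0 HA Ax; have [t [t0 At]] := scale_to0 y A0.
apply: bounded_multiples_eq0 => s; have := HA _ _ (Ax (s / t)) At.
rewrite (linearZP (lHl _)) (linearZP (lHr _)) /GRing.scale /= mulrA.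
by rewrite divfK.
Qed.

Section Coordinates.
Variables (V : topologicalLmodType K) (J : Type).
Variables (f : V -> {ptws J -> K}) (g : {ptws J -> K} -> V).
Hypotheses (lf : forall a x y j, f (a *: x + y) j = a * f x j + f y j)
  (fK : cancel f g) (cg : continuous g).

Lemma wc_coord0 j : f 0 j = 0.
Proof. by have := lf (-1) 0 0 j; rewrite scaler0 addr0 mulN1r addNr. Qed.

Lemma wc_nbhs0 (A : set V) : nbhs (0 : V) A ->
  exists (N : nat) (s : 'I_N -> J) (U : set K),
    nbhs (0 : K) U /\ forall x, (forall k, U (f x (s k))) -> A x.
Proof.
move=> A0; have g0 : g (fun=> 0) = 0.
  by rewrite -[RHS]fK; congr g; apply/funext => j; rewrite wc_coord0.
have : nbhs ((fun=> 0) : {ptws J -> K}) (g @^-1` A) by apply: cg; rewrite g0.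
move=> /ptws_nbhs0 [N [s [U [U0 UA]]]]; exists N, s, U; split=> // x xU.
by rewrite -[x]fK; exact: UA.
Qed.

Definition coord_row N (s : 'I_N -> J) (x : V) : 'rV[K]_N := \row_k f x (s k).

Lemma coord_row_linear N (s : 'I_N -> J) : linear (coord_row s).
Proof. by move=> a x y; apply/rowP => k; rewrite !mxE lf. Qed.

(** This turns boundedness on [A] into vanishing on the common kernel of finitely many
    coordinates. *)
Lemma coord_row0_mul N (s : 'I_N -> J) (U : set K) (A : set V) x :
  nbhs (0 : K) U -> (forall x, (forall k, U (f x (s k))) -> A x) ->
  coord_row s x = 0 -> forall t, A (t *: x).
Proof.
move=> U0 UA x0 t; apply: UA => k.
have -> : f (t *: x) (s k) = coord_row s (t *: x) 0 k by rewrite mxE.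
by rewrite (linearZP (coord_row_linear s)) x0 scaler0 mxE; exact: nbhs_singleton.
Qed.

(** Where [h] is bounded by 1 on a basic neighbourhood, it vanishes on the common kernel of the
    coordinates defining that neighbourhood, hence factors through them. *)
Lemma functional_coords (h : V -> K) : linear (h : V -> K^o) -> continuous h ->
  exists (N : nat) (s : 'I_N -> J) (w : 'cV[K]_N),
    forall x, h x = (coord_row s x *m w) 0 0.
Proof.
move=> lh ch; have A0 : nbhs (0 : V) [set x | `|h x| < 1].
  have : nbhs (0 : V) (h @^-1` ball (0 : K) 1).
    by apply: ch; rewrite (linear0P lh); exact: nbhsx_ballx.
  by apply: filterS => x; rewrite /ball /= sub0r normrN.
have [N [s [U [U0 UA]]]] := wc_nbhs0 A0.
have h0 x : coord_row s x = 0 -> h x = 0.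
  move=> x0; apply: bounded_multiples_eq0 => t.
  by have := coord_row0_mul U0 UA x0 t; rewrite /= (linearZP lh).
have lc := coord_row_linear s.
have [||n [M [fM SM]]] := @subspace_basis _ N [set c | exists x, coord_row s x = c].
- by exists 0; exact: linear0P.
- by move=> a _ _ [x <-] [y <-]; exists (a *: x + y); rewrite lc.
have vP k : exists v, coord_row s v = row k M by apply/SM; exact: row_sub.
have [v Tv] := choice vP.
(* The rows of [M] span the range of the coordinates; as [M *m pinvmx M = 1], this column takes the
   value [h (v k)] on row [k]. *)
exists N, s, (pinvmx M *m \col_k h (v k)) => x.
have /SM/submxP [D cD] : [set c | exists x, coord_row s x = c] (coord_row s x).
  by exists x.
have /h0/eqP : coord_row s (x - \sum_k D 0 k *: v k) = 0.
  rewrite (linearBP lc) (linear_sumP lc) cD mulmx_sum_row.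
  by apply/eqP; rewrite subr_eq0; apply/eqP/eq_bigr => k _; rewrite Tv.
rewrite (linearBP lh) subr_eq0 (linear_sumP lh) => /eqP ->.
rewrite cD -mulmxA (mulmxA M) mulmxVp // mul1mx mxE.
by apply: eq_bigr => k _; rewrite mxE.
Qed.

End Coordinates.

Lemma mul_functional_coords (A : topAlgType K) (f : A -> K) :
  wc_algebra A -> linear (f : A -> K^o) -> continuous f ->
  exists (N : nat) (c : A -> 'rV[K]_N), linear c /\
    forall x, c x = 0 -> forall y, f (x * y) = 0 /\ f (y * x) = 0.
Proof.
move=> [[J [q [g [lq qK gK cq cg]]]] cM] lf cf.
have : nbhs ((0 : A), (0 : A)) [set z : A * A | `|f (z.1 * z.2)| < 1].
  have cfM : continuous (f \o (fun z : A * A => z.1 * z.2)).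
    by move=> z; apply: continuous_comp; [exact: cM|exact: cf].
  have : nbhs ((0 : A), (0 : A)) ((f \o (fun z : A * A => z.1 * z.2)) @^-1` ball (0 : K) 1).
    by apply: cfM; rewrite /= mulr0 (linear0P lf); exact: nbhsx_ballx.
  by apply: filterS => x; rewrite /ball /= sub0r normrN.
case=> -[P Q] /= [P0 Q0] PQ.
(* With the intersection, the same coordinates control left and right arguments. *)
have A0 : nbhs (0 : A) (P `&` Q) by exact: filterI.
have [N [s [U [U0 UA]]]] := wc_nbhs0 lq qK cg A0.
exists N, (coord_row q s); split; first exact: coord_row_linear.
have lfl y : linear (fun x => f (x * y) : K^o).
  by move=> a u v; rewrite mulrDl -scalerAl lf.
have lfr x : linear (fun y => f (x * y) : K^o).
  by move=> a u v; rewrite mulrDr -scalerAr lf.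
move=> x x0 y; have Ax := coord_row0_mul lq U0 UA x0; split.
  apply: (@bounded_bilinear_eq0 A (fun x y => f (x * y)) _ _ _ lfl lfr A0) => //.
  by move=> u v [Pu _] [_ Qv]; exact: (PQ (u, v)).
apply: (@bounded_bilinear_eq0 A (fun x y => f (y * x)) _ _ _ lfr lfl A0) => //.
by move=> u v [_ Qu] [Pv _]; exact: (PQ (v, u)).
Qed.

End WeaklyComplete.

(** * Matrix representations and density in enveloping algebras *)

Section Representations.
Context {K : numFieldType}.

(* The matrix coefficients of a functional f: the bilinear form f (x y) has
   finite rank, and A acts on the span of the functionals f (x -). *)
Lemma functional_rep (A : topAlgType K) (f : A -> K) (u0 : A) :
  wc_algebra A -> linear (f : A -> K^o) -> continuous f -> f u0 != 0 ->
  exists (n : nat) (rho : A -> 'M[K]_n.+1) (r : A -> 'rV[K]_n.+1)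
    (w : 'cV[K]_n.+1),
    [/\ wc_morph rho, linear r, forall u a, r (u * a) = r u *m rho a &
        forall u, f u = (r u *m w) 0 0].
Proof.
move=> wcA lf cf fu0; have [_ cM] := wcA.
have lfl y : linear (fun x => f (x * y) : K^o).
  by move=> s u v; rewrite mulrDl -scalerAl lf.
have lfr x : linear (fun y => f (x * y) : K^o).
  by move=> s u v; rewrite mulrDr -scalerAr lf.
have [N [c [lc c0]]] := mul_functional_coords wcA lf cf.
have [n [a [b [Hba HE]]]] :=
  @dual_bases K A (fun x y => f (x * y)) N c lfl lfr lc c0.
(* Rank 0 would force [f = 0], against [f u0 != 0]. *)
case: n a b Hba HE => [|n] a b Hba HE.
  by move: fu0; rewrite -[u0]mulr1 HE big_ord0 eqxx.
(* In the basis of functionals [f (b k * -)], row [k] of [rho x] is [f (b k * x * -)] and [r u] is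
   [f (u * -)]; [w] evaluates the basis at 1. *)
exists n, (fun x => \matrix_(k, l) f (b k * x * a l)), (fun u => \row_l f (u * a l)),
  (\col_k f (b k)); split; first split.
- move=> s x y; apply/matrixP => k l; rewrite !mxE.
  by rewrite mulrDr mulrDl -scalerAr -scalerAl lf.
- move=> x y; apply/matrixP => k l; rewrite !mxE mulrA -[_ * y * _]mulrA HE.
  by apply: eq_bigr => i _; rewrite !mxE -!mulrA.
- by apply/matrixP => k l; rewrite !mxE mulr1 Hba.
- apply: mx_continuous => k l.
  rewrite (_ : (fun x => _) = f \o (fun x => b k * x * a l)); last first.
    by apply/funext => x; rewrite mxE.
  have cMl y : continuous (fun x : A => y * x).
    move=> x; apply: (@continuous_comp _ _ _ (fun x => (y, x)) (fun z : A * A => z.1 * z.2)).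
      by apply: cvg_pair; [exact: cvg_cst|exact: cvg_id].
    exact: cM.
  have cMr y : continuous (fun x : A => x * y).
    move=> x; apply: (@continuous_comp _ _ _ (fun x => (x, y)) (fun z : A * A => z.1 * z.2)).
      by apply: cvg_pair; [exact: cvg_id|exact: cvg_cst].
    exact: cM.
  move=> x; apply: continuous_comp; last exact: cf.
  apply: (@continuous_comp _ _ _ (fun x => b k * x) (fun x => x * a l)).
    exact: cMl.
  exact: cMr.
- by move=> s x y; apply/rowP => l; rewrite !mxE mulrDl -scalerAl lf.
- move=> u x; apply/rowP => l; rewrite !mxE -mulrA HE.
  by apply: eq_bigr => i _; rewrite !mxE mulrA.
- move=> u; rewrite -[u in LHS]mulr1 HE mxE.
  by apply: eq_bigr => i _; rewrite !mxE mulr1.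
Qed.

Lemma wc_morph_id (A : topAlgType K) : wc_morph (id : A -> A).
Proof. by split=> // x; exact: cvg_id. Qed.

Lemma wc_morph_comp (A B C : topAlgType K) (f : A -> B) (h : B -> C) :
  wc_morph f -> wc_morph h -> wc_morph (h \o f).
Proof.
move=> [lf fM f1 cf] [lh hM h1 ch]; split=> /=.
- by move=> a x y; rewrite lf lh.
- by move=> x y; rewrite fM hM.
- by rewrite f1 h1.
- by move=> x; apply: continuous_comp; [exact: cf|exact: ch].
Qed.

Lemma lie_to_alg_comp (g : topologicalLmodType K) (br : g -> g -> g)
    (A B : topAlgType K) (f : g -> A) (h : A -> B) :
  lie_to_alg br f -> wc_morph h -> lie_to_alg br (h \o f).
Proof.
move=> [lf fbr cf] [lh hM h1 ch]; split=> /=.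
- by move=> a x y; rewrite lf lh.
- by move=> x y; rewrite fbr (linearBP lh) !hM.
- by move=> x; apply: continuous_comp; [exact: cf|exact: ch].
Qed.

Lemma enveloping_inj (g : topologicalLmodType K) (br : g -> g -> g)
    (U A : topAlgType K) (lam : g -> U) (h1 h2 : U -> A) :
  enveloping br lam -> wc_algebra A -> wc_morph h1 -> wc_morph h2 ->
  (forall x, h1 (lam x) = h2 (lam x)) -> forall u, h1 u = h2 u.
Proof.
move=> [wU lU univ] wA m1 m2 e u.
have [h' [mh' e' uniq]] := univ A wA _ (lie_to_alg_comp lU m1).
by rewrite (uniq h1) // (uniq h2) // => x; rewrite -e.
Qed.

(* Two representations intertwined by E on the generators are intertwined on
   all of U: conjugating diag (tau, rho) by [[1, E], [0, 1]] puts
   E rho - tau E in the corner. *)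
Lemma enveloping_intertwine (g : topologicalLmodType K) (br : g -> g -> g)
    (U : topAlgType K) (lam : g -> U) (n : nat) (E : 'M[K]_n.+1)
    (tau rho : U -> 'M[K]_n.+1) :
  enveloping br lam -> wc_morph tau -> wc_morph rho ->
  (forall x, tau (lam x) *m E = E *m rho (lam x)) ->
  forall u, tau u *m E = E *m rho u.
Proof.
move=> env [lt tM t1 ct] [lr rM r1 cr] tE u.
pose B p q s : 'M[K]_(n.+1 + n.+1) := block_mx p q 0 s.
have BZ a p q s p' q' s' : B (a *: p + p') (a *: q + q') (a *: s + s') =
    a *: B p q s + B p' q' s'.
  by rewrite scale_block_mx add_block_mx scaler0 addr0.
have BM p q s p' q' s' : B (p *m p') (p *m q' + q *m s') (s *m s') =
    B p q s *m B p' q' s'.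
  by rewrite mulmx_block !mulmx0 !mul0mx !addr0 !add0r.
(* The size is convertible to [n.+1 + n.+1] and displays the successor that [topAlgType] matrices
   require. *)
pose D (u : U) : 'M[K]_((n + n.+1).+1) := B (tau u) 0 (rho u).
pose D' (u : U) : 'M[K]_((n + n.+1).+1) :=
  B (tau u) (E *m rho u - tau u *m E) (rho u).
have block_cont (F1 F2 F3 : U -> 'M[K]_n.+1) : continuous F1 -> continuous F2 ->
    continuous F3 ->
    continuous (fun u => B (F1 u) (F2 u) (F3 u)).
  move=> c1 c2 c3; apply: mx_continuous => i j.
  have ce (F : U -> 'M[K]_n.+1) i' j' : continuous F -> continuous (fun x => F x i' j').
    move=> cF x; apply: (@continuous_comp _ _ _ F (fun M : 'M[K]_n.+1 => M i' j')).
      exact: cF.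
    exact: coord_continuous.
  rewrite -(splitK i) -(splitK j); case: (fintype.split i) => i';
    case: (fintype.split j) => j' /=.
  - rewrite (_ : (fun x => _) = fun x => F1 x i' j'); first exact: ce.
    by apply/funext => x; rewrite block_mxEul.
  - rewrite (_ : (fun x => _) = fun x => F2 x i' j'); first exact: ce.
    by apply/funext => x; rewrite block_mxEur.
  - rewrite (_ : (fun x => _) = fun x => 0); first by move=> x; exact: cvg_cst.
    by apply/funext => x; rewrite block_mxEdl mxE.
  - rewrite (_ : (fun x => _) = fun x => F3 x i' j'); first exact: ce.
    by apply/funext => x; rewrite block_mxEdr.
have cstc m p (M : 'M[K]_(m, p)) : continuous (fun _ : U => M).
  by move=> x; exact: cvg_cst.
have mD : wc_morph D.
  split.
  - move=> a x y; apply: etrans (BZ a (tau x) 0 (rho x) (tau y) 0 (rho y)).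
    by rewrite -lt -lr scaler0 addr0.
  - move=> x y; apply: etrans (BM (tau x) 0 (rho x) (tau y) 0 (rho y)).
    by rewrite mulmx0 mul0mx addr0 /D tM rM.
  - by rewrite /D t1 r1; exact: esym (@scalar_mx_block K n.+1 n.+1 1).
  - by apply: block_cont.
have mD' : wc_morph D'.
  split.
  - move=> a x y; apply: etrans (BZ a _ _ _ _ _ _).
    rewrite -lt -lr; congr B; rewrite lt lr mulmxDr mulmxDl.
    by rewrite -scalemxAr -scalemxAl scalerBr opprD addrACA.
  - move=> x y; apply: etrans (BM _ _ _ _ _ _).
    rewrite /D' tM rM; congr B.
    (* In the corner, the two terms [tau x *m E *m rho y] cancel. *)
    by rewrite mulmxBr mulmxBl !mulmxA [RHS]addrC subrKA.
  - rewrite /D' t1 r1 mulmx1 mul1mx subrr; exact: esym (@scalar_mx_block K n.+1 n.+1 1).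
  - apply: block_cont => // x.
    apply: (@cvgB _ _ _ _ _ (fun x => E *m rho x) (fun x => tau x *m E)).
      exact: mulmx_continuous.
    exact: mulmx_continuous.
have e x : D (lam x) = D' (lam x) by rewrite /D /D' tE subrr.
have : B _ _ _ = B _ _ _ := enveloping_inj env (matrix_wc_algebra _) mD mD' e u.
by move=> /eq_block_mx [_ /esym/eqP + _ _]; rewrite subr_eq0 => /eqP.
Qed.

(** Density of [D], tested on continuous functionals. Stability is asked for generators only,
    because density of the subalgebra they generate is not known beforehand. *)
Lemma enveloping_vanishing (g : topologicalLmodType K) (br : g -> g -> g)
    (U : topAlgType K) (lam : g -> U) (f : U -> K) (D : set U) :
  enveloping br lam -> linear (f : U -> K^o) -> continuous f ->
  D 1 -> (forall a x y, D x -> D y -> D (a *: x + y)) ->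
  (forall d x, D d -> D (d * lam x)) -> (forall d, D d -> f d = 0) ->
  forall u, f u = 0.
Proof.
move=> env lf cf D1 DD Dlam fD u; have [wU [llam lbr clam] univ] := env.
apply/eqP/negPn/negP => fu.
have [n [rho [r [w [mrho lr rM fE]]]]] := functional_rep wU lf cf fu.
have [lrho rhoM rho1 crho] := mrho.
have D0 : D 0 by have := DD (-1) 1 1 D1 D1; rewrite scaleN1r addNr.
have [||k [M [fM SM]]] := @subspace_basis _ n.+1 [set s | exists2 d, D d & r d = s].
- by exists 0 => //; exact: linear0P.
- by move=> a _ _ [x Dx <-] [y Dy <-]; exists (a *: x + y); [exact: DD|rewrite lr].
(* An idempotent acting on rows from the right: its image is the space [r D] spanned by [M], whose
   elements it fixes. *)
pose E := pinvmx M *m M.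
have EP p (s : 'M[K]_(p, n.+1)) : (s <= M)%MS -> s *m E = s.
  by move=> /submxP [c ->]; rewrite mulmxA -(mulmxA c) mulmxVp // mulmx1.
have ErhoE x : E *m rho (lam x) *m E = E *m rho (lam x).
  rewrite -mulmxA -[in LHS]mulmxA -[RHS]mulmxA; congr (_ *m _).
  (* The rows of [M *m rho (lam x)] stay in [r D], as [D] is stable under generators. *)
  rewrite mulmxA; apply: EP.
  apply/row_subP => i; rewrite row_mul; apply/SM.
  have /SM [d Dd <-] := row_sub i M.
  by exists (d * lam x); [exact: Dlam|exact: rM].
have Ew : E *m w = 0.
  (* The entries of [M *m w] are values of [f] on [D]. *)
  rewrite /E -mulmxA (_ : M *m w = 0) ?mulmx0 //; apply/colP => i.
  have /SM [d Dd rd] := row_sub i M.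
  have := fE d; rewrite fD // rd => /esym; rewrite !mxE => e.
  by rewrite -[RHS]e; apply: eq_bigr => j _; rewrite mxE.
have sigma_lie : lie_to_alg br (fun x => E *m rho (lam x)).
  split.
  - by move=> a x y; rewrite llam lrho mulmxDr scalemxAr.
  - move=> x y; rewrite lbr (linearBP lrho) !rhoM mulmxBr.
    (* Invariance removes the inner [E] from each product. *)
    by congr (_ - _); rewrite [RHS]mulmxA ErhoE -[RHS]mulmxA.
  - apply: mulmx_continuous => x; first exact: cvg_cst.
    by apply: continuous_comp; [exact: clam|exact: crho].
have [tau [mtau tauE _]] := univ _ (matrix_wc_algebra _) _ sigma_lie.
have tE x : tau (lam x) *m E = E *m rho (lam x) by rewrite -tauE.
have iE := enveloping_intertwine env mtau mrho tE.
have r1E : r 1 *m E = r 1 by apply: EP; apply/SM; exists 1.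
(* [f u] is the entry of [r 1 *m E *m rho u *m w = r 1 *m tau u *m E *m w], and [E *m w = 0]. *)
move/eqP: fu; apply; rewrite fE -[u]mul1r rM -r1E -(mulmxA (r 1)) -iE.
by rewrite -(mulmxA (r 1)) -(mulmxA (tau u)) Ew !mulmx0 mxE.
Qed.

End Representations.

(** * Quotients by closed ideals of finite codimension *)

Section Quotients.
Context {K : numFieldType} {g : topologicalLmodType K} {br : g -> g -> g}.

Lemma lie_quotient_continuous (I : set g) (Q : topologicalLmodType K)
    (brQ : Q -> Q -> Q) (p : g -> Q) :
  lie_quotient br I brQ p -> continuous p.
Proof. by move=> [_ _ _ _ oQ]; apply/continuousP => A /oQ. Qed.

Lemma lie_quotient_comp (I : set g) (Q : topologicalLmodType K)
    (brQ : Q -> Q -> Q) (p : g -> Q) (A : topAlgType K) (f : Q -> A) :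
  lie_quotient br I brQ p -> lie_to_alg brQ f -> lie_to_alg br (f \o p).
Proof.
move=> Qp [lf fbr cf]; have [_ [lp pbr] _ _ _] := Qp; split=> /=.
- by move=> a x y; rewrite lp lf.
- by move=> x y; rewrite pbr fbr.
- move=> x; apply: continuous_comp; last exact: cf.
  exact: lie_quotient_continuous Qp x.
Qed.

Lemma lie_quotient_lift (I : set g) (Q : topologicalLmodType K)
    (brQ : Q -> Q -> Q) (p : g -> Q) (A : topAlgType K) (f : g -> A) :
  lie_quotient br I brQ p -> lie_to_alg br f -> (forall x, I x -> f x = 0) ->
  exists f' : Q -> A, lie_to_alg brQ f' /\ forall x, f' (p x) = f x.
Proof.
move=> [_ [lp pbr] psurj pI oQ] [lf fbr cf] fI.
(* Any set-theoretic section will do: [f] is constant on the fibres of [p]. *)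
have [q qK] := choice psurj.
have f'E x : f (q (p x)) = f x.
  apply/eqP; rewrite -subr_eq0 -(linearBP lf); apply/eqP/fI/pI.
  by rewrite (linearBP lp) qK subrr.
exists (f \o q); split=> //; split=> [a x y|x y|] /=.
- by rewrite -{1}(qK x) -{1}(qK y) -lp f'E lf.
- by rewrite -{1}(qK x) -{1}(qK y) -pbr f'E fbr.
- apply/continuousP => V oV; apply/oQ.
  rewrite (_ : _ @^-1` _ = f @^-1` V); first by move/continuousP: cf; exact.
  by apply/seteqP; split => x /=; rewrite f'E.
Qed.

(** The source of indices in [ideal_idx br]. Closedness comes from closed points in matrix space,
    finite codimension from flattening the matrices by [mxvec]. *)
Lemma fincodim_ideal_kernel (n : nat) (sigma : g -> 'M[K]_n.+1) :
  lie_to_alg br sigma -> fincodim_ideal br [set x | sigma x = 0].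
Proof.
move=> [ls sbr cs]; split => /=.
- rewrite (_ : [set x | _] = sigma @^-1` [set 0]) //.
  apply: preimage_closed => [x _|]; first exact: cs.
  apply: accessible_closed_set1; apply: hausdorff_accessible.
  exact: norm_hausdorff.
- exact: linear0P.
- by move=> a x y sx sy; rewrite ls sx sy scaler0 addr0.
- by move=> x y sy; rewrite sbr sy mulr0 mul0r subr0.
have [||x|m [v vP]] := @relation_fincodim K g _ (fun x c => mxvec (sigma x) = c).
- by rewrite (linear0P ls) linear0.
- by move=> a x y _ _ <- <-; rewrite ls linearP.
- by exists (mxvec (sigma x)).
exists m, v => x; have [e ex] := vP x; exists e.
by apply: (can_inj mxvecK); rewrite ex linear0.
Qed.

Lemma fincodim_idealI (I J : set g) :
  fincodim_ideal br I -> fincodim_ideal br J -> fincodim_ideal br (I `&` J).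
Proof.
move=> [cI I0 ID Ibr [n [v vP]]] [cJ J0 JD Jbr [m [w wP]]]; split.
- exact: closedI.
- by [].
- by move=> a x y [Ix Jx] [Iy Jy]; split; [exact: ID|exact: JD].
- by move=> x y [Iy Jy]; split; [exact: Ibr|exact: Jbr].
pose comb N (u : 'I_N -> g) (c : 'rV[K]_N) := \sum_k c 0 k *: u k.
have lcomb N (u : 'I_N -> g) : linear (comb N u).
  move=> a c d; rewrite /comb scaler_sumr -big_split; apply: eq_bigr => k _ /=.
  by rewrite !mxE scalerDl scalerA.
(* The two halves of [c] are coefficients of [x] modulo [I] and modulo [J]; so [T x 0] means that
   [x] lies in both. *)
pose T (x : g) (c : 'rV[K]_(n + m)) :=
  I (x - comb n v (lsubmx c)) /\ J (x - comb m w (rsubmx c)).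
have [||x|N [u uP]] := @relation_fincodim K g _ T.
- by split; rewrite linear0 (linear0P (lcomb _ _)) subr0.
- move=> a x y c d [Ic Jc] [Id Jd].
  split; rewrite linearP (lcomb _ _) opprD addrACA -scalerBr;
    [exact: ID|exact: JD].
- have [c Ic] := vP x; have [d Jd] := wP x.
  exists (row_mx (\row_k c k) (\row_k d k)); rewrite /T row_mxKl row_mxKr /comb.
  split.
    by rewrite (eq_bigr (fun k => c k *: v k)) // => k _; rewrite mxE.
  by rewrite (eq_bigr (fun k => d k *: w k)) // => k _; rewrite mxE.
exists N, u => x; have [e [Ie Je]] := uP x; exists e.
by move: Ie Je; rewrite !linear0 !(linear0P (lcomb _ _)) !subr0.
Qed.

Lemma ideal_idx_lower (i j : ideal_idx br) :
  exists k : ideal_idx br, sval k `<=` sval i /\ sval k `<=` sval j.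
Proof.
exists (exist _ _ (fincodim_idealI (svalP i) (svalP j))).
by split=> x [].
Qed.

Lemma ideal_idx_lower_fin (N : nat) (t : 'I_N -> ideal_idx br) (i : ideal_idx br) :
  exists k : ideal_idx br,
    sval k `<=` sval i /\ forall l, sval k `<=` sval (t l).
Proof.
elim: N t => [|N IH] t; first by exists i; split=> // -[].
have [k [ki kt]] := IH (fun l => t (lift ord0 l)).
have [k' [k'k k't]] := ideal_idx_lower k (t ord0).
exists k'; split=> [|l]; first exact: subset_trans ki.
have [l' ->|->] := unliftP ord0 l; last exact: k't.
exact: subset_trans (kt l').
Qed.

End Quotients.

(** * The inverse system of enveloping algebras and its limit *)

Section EnvelopingLimit.
Context {K : numFieldType} {g : topologicalLmodType K} {br : g -> g -> g}.
Context {Q : ideal_idx br -> topologicalLmodType K}.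
Context {brQ : forall i, Q i -> Q i -> Q i} {p : forall i, g -> Q i}.
Context {Ug : topAlgType K} {lam : g -> Ug}.
Context {UQ : ideal_idx br -> topAlgType K} {lamQ : forall i, Q i -> UQ i}.
Arguments lamQ : clear implicits.
Hypothesis Qp : forall i, lie_quotient br (sval i) (@brQ i) (p i).
Hypothesis envU : enveloping br lam.
Hypothesis envQ : forall i, enveloping (@brQ i) (lamQ i).

Lemma lamQ_p_lie i : lie_to_alg br (lamQ i \o p i).
Proof. by have [_ lQ _] := envQ i; exact: lie_quotient_comp (Qp i) lQ. Qed.

(** The composite [lamQ i \o p i] kills the smaller ideal, so it descends along [p j] and extends to
    [UQ j]; the map between the quotients is never formed. *)
Lemma enveloping_transition : exists phi : forall i j, UQ j -> UQ i,
  forall i j, sval j `<=` sval i ->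
    wc_morph (phi i j) /\ forall x, phi i j (lamQ j (p j x)) = lamQ i (p i x).
Proof.
suff H i j : exists h : UQ j -> UQ i, sval j `<=` sval i ->
    wc_morph h /\ forall x, h (lamQ j (p j x)) = lamQ i (p i x).
  by exists (fun i j => sval (cid (H i j))) => i j; exact: (svalP (cid (H i j))).
(* For other pairs of indices [phi] takes the default value 0. *)
have [ji|nji] := pselect (sval j `<=` sval i); last by exists (fun=> 0) => /nji.
have [wi _ _] := envQ i; have [_ _ univ] := envQ j.
have [f [lf fE]] : exists f : Q j -> UQ i, lie_to_alg (@brQ j) f /\
    forall x, f (p j x) = lamQ i (p i x).
  apply: lie_quotient_lift (Qp j) (lamQ_p_lie i) _ => x /ji ix /=.
  have [_ _ _ pI _] := Qp i; have [_ [ll _ _] _] := envQ i.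
  by move/pI: ix => ->; exact: linear0P.
have [h [mh hE _]] := univ _ wi f lf.
by exists h => _; split=> // x; rewrite -hE fE.
Qed.

Lemma enveloping_projection : exists psi : forall i, Ug -> UQ i,
  forall i, wc_morph (psi i) /\ forall x, psi i (lam x) = lamQ i (p i x).
Proof.
suff H i : exists h : Ug -> UQ i,
    wc_morph h /\ forall x, h (lam x) = lamQ i (p i x).
  by exists (fun i => sval (cid (H i))) => i; exact: (svalP (cid (H i))).
have [wi _ _] := envQ i; have [_ _ univ] := envU.
have [h [mh hE _]] := univ _ wi _ (lamQ_p_lie i).
by exists h; split=> // x; rewrite -hE.
Qed.

Lemma envelopingQ_inj i (A : topAlgType K) (h1 h2 : UQ i -> A) :
  wc_algebra A -> wc_morph h1 -> wc_morph h2 ->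
  (forall x, h1 (lamQ i (p i x)) = h2 (lamQ i (p i x))) -> forall u, h1 u = h2 u.
Proof.
move=> wA m1 m2 e; apply: (enveloping_inj (envQ i) wA m1 m2) => q.
by have [_ _ /(_ q) [x <-] _ _] := Qp i; exact: e.
Qed.

Variables (phi : forall i j, UQ j -> UQ i) (psi : forall i, Ug -> UQ i).
Arguments phi : clear implicits.
Hypothesis phiP : forall i j, sval j `<=` sval i ->
  wc_morph (phi i j) /\ forall x, phi i j (lamQ j (p j x)) = lamQ i (p i x).
Hypothesis psiP : forall i, wc_morph (psi i) /\
  forall x, psi i (lam x) = lamQ i (p i x).

Lemma phi_id i u : phi i i u = u.
Proof.
have [m e] := phiP (@subset_refl _ (sval i)).
by have [wi _ _] := envQ i; exact: (envelopingQ_inj wi m (wc_morph_id _)).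
Qed.

Lemma phi_comp i j k u : sval j `<=` sval i -> sval k `<=` sval j ->
  phi i j (phi j k u) = phi i k u.
Proof.
move=> ji kj; have [mij eij] := phiP ji; have [mjk ejk] := phiP kj.
have [mik eik] := phiP (subset_trans kj ji); have [wi _ _] := envQ i.
apply: (envelopingQ_inj wi (wc_morph_comp mjk mij) mik) => x.
by rewrite /= ejk eij eik.
Qed.

Lemma phi_psi i j u : sval j `<=` sval i -> phi i j (psi j u) = psi i u.
Proof.
move=> ji; have [mij eij] := phiP ji; have [mj ej] := psiP j.
have [mi ei] := psiP i; have [wi _ _] := envQ i.
apply: (enveloping_inj envU wi (wc_morph_comp mj mij) mi) => x.
by rewrite /= ej eij ei.
Qed.

(* A matrix representation of U(g) restricts to a Lie morphism on g whose
   kernel is an index i, hence it factors through U(g/i). *)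
Lemma functional_factor (f : Ug -> K) (u0 : Ug) :
  linear (f : Ug -> K^o) -> continuous f -> f u0 != 0 ->
  exists (i : ideal_idx br) (l : UQ i -> K),
    [/\ linear (l : UQ i -> K^o), continuous l & forall u, l (psi i u) = f u].
Proof.
move=> lf cf fu0; have [wU lieU _] := envU.
have [n [rho [r [w [mrho lr rM fE]]]]] := functional_rep wU lf cf fu0.
have lie_rho := lie_to_alg_comp lieU mrho.
pose i : ideal_idx br := exist _ _ (fincodim_ideal_kernel lie_rho).
have [s [lie_s sE]] := lie_quotient_lift (Qp i) lie_rho (fun _ => id).
have [_ _ univ] := envQ i.
have [sigma [msigma sigmaE _]] := univ _ (matrix_wc_algebra n) s lie_s.
have [mpsi psiE] := psiP i; have [lsigma _ _ csigma] := msigma.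
have sp u : sigma (psi i u) = rho u.
  have ms := wc_morph_comp mpsi msigma.
  apply: (enveloping_inj envU (matrix_wc_algebra n) ms mrho) => x.
  by rewrite /= psiE -sigmaE sE.
(* Since [r u = r 1 *m rho u], this recovers [f] from [sigma]. *)
exists i, (fun y => (r 1 *m sigma y *m w) 0 0); split.
- move=> a x y; rewrite lsigma mulmxDr mulmxDl mxE; congr (_ + _).
  by rewrite -scalemxAr -scalemxAl mxE.
- move=> y; apply: (@continuous_comp _ _ _ (fun y => r 1 *m sigma y *m w)
    (fun M : 'M[K]_(1, 1) => M 0 0)); last exact: coord_continuous.
  apply: (mulmx_continuous (F := fun y => r 1 *m sigma y) (G := fun=> w)).
    apply: (mulmx_continuous (F := fun=> r 1)) => // x; exact: cvg_cst.
  by move=> x; exact: cvg_cst.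
- by move=> u; rewrite sp -rM mul1r -fE.
Qed.

(** The image of [psi i] is dense: it contains 1 and, [p i] being onto, every generator, so it is
    stable under right multiplication by them. *)
Lemma psi_vanishing i (f : UQ i -> K) :
  linear (f : UQ i -> K^o) -> continuous f -> (forall u, f (psi i u) = 0) ->
  forall y, f y = 0.
Proof.
move=> lf cf fpsi; have [[lp pM p1 _] pE] := psiP i.
apply: (enveloping_vanishing (D := range (psi i)) (envQ i) lf cf).
- by exists 1.
- by move=> a _ _ [x _ <-] [y _ <-]; exists (a *: x + y).
- move=> _ q [u _ <-]; have [_ _ /(_ q) [x <-] _ _] := Qp i.
  by exists (u * lam x) => //; rewrite pM pE.
- by move=> _ [u _ <-].
Qed.

Lemma omega_homeo_onto :
  homeo_onto
    (fun u : Ug => (fun i => psi i u) : prodT (fun i => UQ i : topologicalType))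
    [set y : prodT (fun i => UQ i : topologicalType) |
       forall i j : ideal_idx br, sval j `<=` sval i -> phi i j (y j) = y i].
Proof.
have [[[J [f [h [lf fK hK cf ch]]]] cM] _ _] := envU.
have coordP j : exists i, exists l : UQ i -> K,
    [/\ linear (l : UQ i -> K^o), continuous l & forall u, l (psi i u) = f u j].
  (* All coordinates of [h (fun=> 1)] equal 1, so no coordinate functional is zero. *)
  apply: (@functional_factor (fun u => f u j) (h (fun=> 1))).
  - by move=> a x y; rewrite lf.
  - move=> u; apply: (@continuous_comp _ _ _ f (fun y : {ptws J -> K} => y j)).
      exact: cf.
    exact: eval_continuous.
  - by rewrite hK oner_neq0.
have [i_ exl] := choice coordP.
(* Chosen after [i_], because the type of [l j] depends on [i_ j]. *)
pose l j := sval (cid (exl j)).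
have lP j : [/\ linear (l j : UQ (i_ j) -> K^o), continuous (l j) &
    forall u, l j (psi (i_ j) u) = f u j] := svalP (cid (exl j)).
pose theta (y : prodT (fun i => UQ i : topologicalType)) : Ug :=
  h (fun j => l j (y (i_ j))).
have thetaK u : theta (fun i => psi i u) = u.
  rewrite /theta -[RHS]fK; congr h; apply/funext => j.
  by have [_ _ ->] := lP j.
have ctheta : continuous theta.
  move=> y; apply: (@continuous_comp _ _ _
    (fun y : prodT (fun i => UQ i : topologicalType) =>
      (fun j => l j (y (i_ j))) : {ptws J -> K}) h); last exact: ch.
  apply: continuous_prod_topology => j {}y; have [_ cl _] := lP j.
  apply: (@continuous_comp _ _ _
    (fun y : prodT (fun i => UQ i : topologicalType) => y (i_ j)) (l j)).
    exact: eval_continuous.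
  exact: cl.
split.
- by move=> u v e; rewrite -(thetaK u) -(thetaK v) e.
- apply/seteqP; split=> [_ [u _ <-] i j ji|y yL]; first exact: phi_psi.
  exists (theta y) => //; apply: functional_extensionality_dep => i.
  have [[[J' [f' [h' [lf' fK' _ cf' _]]]] _] _ _] := envQ i.
  rewrite -[LHS]fK' -[RHS]fK'; congr h'; apply/funext => j'.
  have [[lpsi _ _ cpsi] _] := psiP i.
  have cf'j : continuous (fun z => f' z j').
    move=> z; apply: (@continuous_comp _ _ _ f' (fun y : {ptws J' -> K} => y j')).
      exact: cf'.
    exact: eval_continuous.
  have lF : linear (fun u => f' (psi i u) j' : K^o).
    by move=> a u v; rewrite lpsi lf'.
  have cF : continuous (fun u => f' (psi i u) j').
    by move=> u; apply: (@continuous_comp _ _ _ (psi i) (fun z => f' z j'));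
      [exact: cpsi|exact: cf'j].
  have [N [s [w FE]]] := functional_coords lf fK ch lF cF.
  (* Coordinate [j'] of [psi i] involves only the coordinates [s] of [Ug]; all indices concerned are
     reached from one [k]. *)
  have [k [ki ks]] := ideal_idx_lower_fin (fun n : 'I_N => i_ (s n)) i.
  have [[lphi _ _ cphi] _] := phiP ki.
  pose G z := f' (phi i k z) j' -
    \sum_n l (s n) (phi (i_ (s n)) k z) * w n 0.
  have G0 : forall z, G z = 0.
    apply: psi_vanishing.
    + move=> a x z; rewrite /G lphi lf' scalerDr.
      rewrite -[RHS]addrACA; congr (_ + _).
      rewrite scalerN scaler_sumr -opprD -big_split; congr (- _).
      apply: eq_bigr => n _ /=; have [[lphin _ _ _] _] := phiP (ks n).
      by have [ll _ _] := lP (s n); rewrite lphin ll mulrDl /GRing.scale /= mulrA.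
    + move=> z; apply: (@cvgB _ K^o _ _ _ (fun z => f' (phi i k z) j')).
        apply: (@continuous_comp _ _ _ (phi i k) (fun z => f' z j')).
          exact: cphi.
        exact: cf'j.
      apply: sum_continuous => n {}z; have [[_ _ _ cphin] _] := phiP (ks n).
      apply: (@continuousM K _ (fun z => l (s n) (phi (i_ (s n)) k z)) (fun=> w n 0)).
        have [_ cl _] := lP (s n).
        by apply: (@continuous_comp _ _ _ (phi (i_ (s n)) k) (l (s n)));
          [exact: cphin|exact: cl].
      exact: cvg_cst.
    (* On the image of [psi k], [G] vanishes by the expansion [FE]. *)
    + move=> u; rewrite /G phi_psi // FE mxE; apply/eqP.
      rewrite subr_eq0; apply/eqP/eq_bigr => n _; rewrite mxE.
      by rewrite phi_psi //; have [_ _ ->] := lP (s n).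
  (* By compatibility of [y], the two terms of [G (y k)] are the coordinates [j'] of [y i] and of
     [psi i (theta y)]. *)
  have /eqP := G0 (y k); rewrite subr_eq0 yL // => /eqP ->.
  rewrite FE mxE; apply: eq_bigr => n _; rewrite mxE yL //.
  by rewrite /theta hK.
- apply: continuous_prod_topology => i; have [[_ _ _ cpsi] _] := psiP i.
  exact: cpsi.
- by exists theta; split=> //; exact: continuous_subspaceT.
Qed.

End EnvelopingLimit.

Theorem theorem1p10 (R : realType) (b : bool)
    (g : topologicalLmodType (Kfield R b)) (br : g -> g -> g)
    (Q : ideal_idx br -> topologicalLmodType (Kfield R b))
    (brQ : forall i, Q i -> Q i -> Q i)
    (p : forall i, g -> Q i)
    (Ug : topAlgType (Kfield R b)) (lam : g -> Ug)
    (UQ : ideal_idx br -> topAlgType (Kfield R b))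
    (lamQ : forall i, Q i -> UQ i) :
  topLie br ->
  (forall i, lie_quotient br (sval i) (brQ i) (p i)) ->
  profinite_dim p ->
  enveloping br lam ->
  (forall i, enveloping (brQ i) (lamQ i)) ->
  exists (phi : forall i j : ideal_idx br, UQ j -> UQ i)
         (psi : forall i : ideal_idx br, Ug -> UQ i),
    [/\ (* the index set I(g) is directed downwards *)
        (forall i j : ideal_idx br, exists k : ideal_idx br,
            sval k `<=` sval i /\ sval k `<=` sval j),
        (* phi i j = U(p_IJ) for J <= I *)
        (forall i j : ideal_idx br, sval j `<=` sval i ->
           wc_morph (phi i j) /\
           forall x : g, phi i j (lamQ j (p j x)) = lamQ i (p i x)),
        (* inverse system *)
        (forall (i : ideal_idx br) (u : UQ i), phi i i u = u) /\
        (forall i j k : ideal_idx br, sval j `<=` sval i -> sval k `<=` sval j ->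
           forall u : UQ k, phi i j (phi j k u) = phi i k u),
        (* psi i = U(p_I) *)
        (forall i : ideal_idx br, wc_morph (psi i) /\
           forall x : g, psi i (lam x) = lamQ i (p i x)) &
        (* omega : U(g) -> lim U(g/I) is bijective onto the limit and a
           homeomorphism (it is componentwise an algebra morphism) *)
        homeo_onto
          (fun u : Ug => (fun i => psi i u) : prodT (fun i => UQ i : topologicalType))
          [set y : prodT (fun i => UQ i : topologicalType) |
             forall i j : ideal_idx br, sval j `<=` sval i -> phi i j (y j) = y i]].
Proof.
move=> _ Qp _ envU envQ.
have [phi phiP] := enveloping_transition Qp envQ.
have [psi psiP] := enveloping_projection Qp envU envQ.
exists phi, psi; split.
- exact: ideal_idx_lower.
- exact: phiP.
- split=> [i u|i j k ji kj u]; first exact: (phi_id Qp envQ phiP).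
  exact: (phi_comp Qp envQ phiP).
- exact: psiP.
- exact: (omega_homeo_onto Qp envU envQ phiP psiP).
Qed.
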